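(* If a finite abelian group $G$ is written as $$G\cong\prod_{i=1}^n C_{m_i},$$ where $m_1,\ldots,m_n$ are positive integers with $m_1\mid m_2\mid\cdots\mid m_n$, then $$r_3(G)\leqslant (0.886)^{\operatorname{rk}_8(G)}|G|,$$ where $\operatorname{rk}_8(G)$ denotes the number of indices $i\in\{1,\ldots,n\}$ with $8\mid m_i$.
   Context: $C_m$ denotes the cyclic group of order $m$. A non-trivial three-term progression in a finite group $G$ (written multiplicatively) is an ordered triple $(a,b,c)\in G^3$ of mutually distinct elements such that $ac=b^2$. $r_3(G)$ denotes the size of the largest subset $A\subset G$ containing no non-trivial three-term progression (i.e. no such triple with $a,b,c\in A$). *)

(* Defs.v *)
From mathcomp Require Import all_boot all_order all_algebra all_fingroup.

Set Implicit Arguments.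
Unset Strict Implicit.
Unset Printing Implicit Defensive.

Import GroupScope.

Definition nontrivial_3AP (gT : finGroupType) (a b c : gT) : bool :=
  [&& a != b, b != c, a != c & a * c == b ^+ 2].

Definition progression_free (gT : finGroupType) (A : {set gT}) : bool :=
  [forall a in A, forall b in A, forall c in A, ~~ nontrivial_3AP a b c].

Definition r3 (gT : finGroupType) (G : {set gT}) : nat :=
  \max_(A : {set gT} | (A \subset G) && progression_free A) #|A|.

(* [Zp k] is used rather than the full type ['Z_k], which has two elements
   when [k = 1]; for every [k > 0], [Zp k] is cyclic of order [k]. *)
Definition prod_cyclic n (m : 'I_n -> nat) :
    {set {dffun forall i : 'I_n, 'Z_(m i)}} :=
  setXn (fun i : 'I_n => Zp (m i)).

Canonical prod_cyclic_group n (m : 'I_n -> nat) :=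
  [group of prod_cyclic m].

Definition rk8 n (m : 'I_n -> nat) : nat := #|[set i : 'I_n | 8 %| m i]|.

(* Main.v *)
Require Import Defs.
From mathcomp Require Import all_boot all_order all_algebra all_fingroup.
From mathcomp Require Import zify.
From Stdlib Require Zify.
Set Implicit Arguments.
Unset Strict Implicit.
Unset Printing Implicit Defensive.

Import Order.TTheory GRing.Theory Num.Theory.
Local Open Scope ring_scope.

(** Since [8] divides exactly [rk8 m] of the [m i], [G] contains a copy
    of [C_8 ^ J] with [#|J| = rk8 m], and averaging a progression-free subset of
    [G] over the translates of that copy reduces the claim to
    [C_8 ^ J] ([card_progression_free_cyclic8]).  There, powers of a
    progression-free set are progression-free in the powers of the group, so
    every subexponential loss may be ignored and it suffices to bound [#|A|] by
    [11 * (0.886 * 8) ^ n] when [136] divides [n] ([leq_of_powers],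
    [card_ap_free_multiple]).

    The bound is a Croot-Lev-Pach rank argument.  Write [x] in [C_8 ^ n] as
    three binary vectors, its parity, [bit1] and [bit2].  If [x] and [y] have
    the same parity [g], then [x + y] is twice an element, determined modulo
    [4] by [g + x / 2 + y / 2]; so if [A] is progression-free and [x <> y] are
    in [A], this vector of [C_4 ^ n] avoids [A] modulo [4], whereas for [x = y]
    it is [x] modulo [4].  Take a polynomial [P] over the field with
    two elements, of degree at most [2 * s], which vanishes off [A] modulo [4]:
    its values at these midpoints form a diagonal matrix whose rank is at most
    twice the dimension of the functions of degree at most [s], restricted to
    one parity class of [A] ([diag_set_card]).  And [P] can be taken to vanish
    on at most as many points of [A] modulo [4] as there are monomials of
    degree above [2 * s] ([exists_large_support]).  Hence [card_band]: it is a good bound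
    when few elements of [A] share a residue modulo [4].

    The same argument modulo [2] inside one fibre of reduction modulo [4]
    bounds, in each parity class, the number of rich residues, those
    with many elements of [A] above them ([card_rich]).  Balancing these
    two bounds alone gives only [0.88624].  The gain comes from a third
    estimate: when a parity class meets few residues,
    monomials of small degree in the upper bits span few functions on it,
    because their factor in the lower bits can be replaced by the indicators
    of these residues ([spanned_lo_hi]).

    So [A] is cut in three according to the size of the fibres
    ([card_ap_free]): on small fibres [card_band] suffices; on medium
    ones it is used with [spanned_lo_hi]; and there are so few large ones that
    counting them is enough.  The numbers of monomials that occur are
    estimated by exponential moments ([weighted_count]). *)

(** * Binomial coefficients modulo 2 *)

Local Notation F2 := 'F_2.

Lemma F2_natr_odd (n : nat) : n%:R = (odd n)%:R :> F2.
Proof. by rewrite -(@Fp_nat_mod 2) // modn2. Qed.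

(** For [q > 0], this holds exactly when [q] is a power of two.  It says that
    [(1 + X) ^ q = 1 + X ^ q] modulo [2], which makes [z |-> 'C(z, k)] with
    [k < q] periodic of period [q] modulo [2], hence a function on the cyclic
    group of order [q]. *)
Definition pascal_trivial (q : nat) :=
  forall i : nat, (0 < i < q)%N -> ~~ odd 'C(q, i).

Lemma pascal_trivial2 : pascal_trivial 2.
Proof. by case=> [|[|i]] //; rewrite ltnS. Qed.

Lemma pascal_trivial4 : pascal_trivial 4.
Proof. by case=> [|[|[|[|i]]]]. Qed.

Lemma bin_mod (q k z : nat) : pascal_trivial q -> (k < q)%N ->
  'C(z %% q, k)%:R = 'C(z, k)%:R :> F2.
Proof.
move=> triv_q lt_kq; rewrite [in RHS](divn_eq z q).
elim: (z %/ q)%N => [|c IHc]; first by rewrite mul0n.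
rewrite mulSn -addnA -binomial.Vandermonde natr_sum big_ord_recl /=.
rewrite bin0 mul1n subn0 -IHc big1 ?addr0 // => i _.
rewrite natrM F2_natr_odd (negbTE (triv_q _ _)) ?mul0r //.
by rewrite /= (leq_ltn_trans _ lt_kq) // /bump leq0n add1n.
Qed.

(** * Polynomial functions on powers of a cyclic 2-group *)

Section Polynomials.
Variables (I : finType) (p : nat).
Local Notation q := p.+1.
Hypothesis triv_q : pascal_trivial q.
Local Notation V := {ffun I -> 'I_q}.
Implicit Types (k i j u v z h : V).

(** The [monom k] play the part of the monomials: for [q = 2] they are the
    squarefree ones.  Binomial coefficients are used because the Vandermonde
    identity makes degrees add up under translation, for any [q = 2 ^ r]. *)
Definition monom (k z : V) : F2 := \prod_l 'C(z l, k l)%:R.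
Definition weight k := (\sum_l k l)%N.
Definition lev (i k : V) := [forall l, (i l <= k l)%N].
Definition subv (k i : V) : V := [ffun l => inord (k l - i l)].
Definition peval (c : V -> F2) (z : V) := \sum_k c k * monom k z.

Lemma subvE k i l : (subv k i l = k l - i l :> nat)%N.
Proof. by rewrite ffunE inordK // ltnS (leq_trans (leq_subr _ _)) // -ltnS. Qed.

Lemma weight_subv k i : lev i k -> weight k = (weight i + weight (subv k i))%N.
Proof.
move/forallP=> le_ik; rewrite -big_split /=; apply: eq_bigr => l _.
by rewrite subvE subnKC.
Qed.

Lemma monomD k u v :
  monom k (u + v) = \sum_(i | lev i k) monom i u * monom (subv k i) v.
Proof.
pose f l (i : 'I_q) : F2 :=
  if (i <= k l)%N then 'C(u l, i)%:R * 'C(v l, k l - i)%:R else 0.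
have digit l : 'C((u + v)%R l, k l)%:R = \sum_i f l i.
  rewrite ffunE /= bin_mod // -binomial.Vandermonde natr_sum.
  rewrite -big_mkcond /= (big_ord_widen_cond q xpredT
    (fun i : nat => ('C(u l, i) * 'C(v l, k l - i))%:R)) //.
  by apply: eq_big => [i|i _]; rewrite ?ltnS ?natrM.
rewrite /monom (eq_bigr _ (fun l _ => digit l)) bigA_distr_bigA [RHS]big_mkcond /=.
apply: eq_bigr => i _; case: ifPn => [/forallP le_ik | ].
  rewrite -big_split; apply: eq_bigr => l _ /=.
  by rewrite /f le_ik subvE.
rewrite negb_forall => /existsP[l nle].
by rewrite (bigD1 l) //= /f (negbTE nle) mul0r.
Qed.

Definition translate (c : V -> F2) (h i : V) : F2 :=
  \sum_(k | lev i k) c k * monom (subv k i) h.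

Lemma peval_translate c h z : peval (translate c h) z = peval c (z + h).
Proof.
rewrite /peval; under [RHS]eq_bigr do rewrite monomD mulr_sumr.
rewrite (exchange_big_dep xpredT) //=; apply: eq_bigr => i _.
rewrite mulr_suml; apply: eq_bigr => k _.
by rewrite -!mulrA [monom i z * _]mulrC.
Qed.

Definition deg_le d (c : V -> F2) := forall k, (d < weight k)%N -> c k = 0.

Lemma deg_le_translate d c h : deg_le d c -> deg_le d (translate c h).
Proof.
move=> deg_c i lt_di; apply: big1 => k le_ik.
by rewrite deg_c ?mul0r // (leq_trans lt_di) // (weight_subv le_ik) leq_addr.
Qed.

(** This is [(1 + 1) ^ z] modulo [2], coordinate by coordinate.  Translating
    the point [0], it writes every indicator function in terms of the
    [monom k]. *)
Lemma sum_monom z : \sum_k monom k z = (z == 0)%:R.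
Proof.
rewrite -(bigA_distr_bigA (fun l (k : 'I_q) => 'C(z l, k)%:R : F2)) /=.
have digit l : \sum_(k < q) 'C(z l, k)%:R = (z l == 0)%:R :> F2.
  rewrite -natr_sum.
  have ->: (\sum_(k < q) 'C(z l, k) = 2 ^ z l)%N.
    rewrite -[2%N]/(1 + 1)%N expnDn.
    rewrite (big_ord_widen q (fun k : nat => 'C(z l, k) * (1 ^ (z l - k) * 1 ^ k))%N) //.
    rewrite [RHS]big_mkcond; apply: eq_bigr => k _.
    by rewrite !exp1n !muln1 ltnS; case: leqP => // /bin_small.
  by rewrite F2_natr_odd oddX orbF.
rewrite (eq_bigr _ (fun l _ => digit l)).
case: eqP => [->|nz]; first by rewrite big1 // => l _; rewrite ffunE.
apply/eqP; rewrite prodf_seq_eq0; apply/hasP.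
have /existsP[l zl]: [exists l, z l != 0].
  rewrite -negb_forall; apply/forallP => z0; apply: nz.
  by apply/ffunP=> l; rewrite ffunE (eqP (z0 l)).
by exists l; rewrite ?mem_index_enum //= (negbTE zl).
Qed.

(** Expands [P] as the sum of the [P a] times the indicator of [a].  The degree
    condition on [P] thus becomes a system of linear equations in the values
    of [P], one for each monomial of large degree. *)
Definition coefs (P : V -> F2) k : F2 :=
  \sum_a P a * translate (fun _ => 1) (- a) k.

Lemma peval_coefs P z : peval (coefs P) z = P z.
Proof.
rewrite /peval; under eq_bigr do rewrite mulr_suml.
rewrite exchange_big /=.
under eq_bigr => a _.
  under eq_bigr do rewrite -mulrA.
  rewrite -mulr_sumr -/(peval (translate _ (- a)) z) peval_translate /peval.
  under eq_bigr do rewrite mul1r.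
  rewrite sum_monom subr_eq0.
  over.
rewrite (bigD1 z) //= eqxx mulr1 big1 ?addr0 // => a.
by rewrite eq_sym => /negbTE->; rewrite mulr0.
Qed.

Lemma coefsB P Q k : coefs (P \- Q) k = coefs P k - coefs Q k.
Proof. by rewrite -sumrB; apply: eq_bigr => a _; rewrite mulrBl. Qed.

(** Functions supported in [Z] outnumber the possible values of their
    coefficients of degree above [d], so two of them share these
    coefficients, and their difference has degree at most [d]. *)
Lemma exists_small_support d (Z : {set V}) :
    (#|[set k : V | d < weight k]| < #|Z|)%N ->
  exists Q : V -> F2, [/\ deg_le d (coefs Q), forall z, z \notin Z -> Q z = 0
    & exists z, Q z != 0].
Proof.
set H := [set k : V | _] => lt_HZ.
pose f (Q : {ffun V -> F2}) : {ffun V -> F2} :=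
  [ffun k => if k \in H then coefs Q k else 0].
have /dinjectivePn[P ZP [Q /andP[/= neQP ZQ] eqf]]:
    ~~ dinjectiveb f (pffun_on (0%R : F2) Z predT).
  apply/negP => /dinjectiveP inj_f.
  have := card_in_image inj_f; rewrite card_pffun_on cardT -cardE card_Fp // => cardf.
  have: (#|[seq f x | x in pffun_on (0%R : F2) Z predT]| <= #|pffun_on (0%R : F2) H predT|)%N.
    apply/subset_leq_card/subsetP => _ /imageP[Q _ ->].
    apply/pffun_onP; split=> //; apply/subsetP => k; rewrite inE /= ffunE.
    by case: ifP; rewrite ?eqxx.
  by rewrite cardf card_pffun_on cardT -cardE card_Fp // leq_exp2l // leqNgt lt_HZ.
have vanish (B : {ffun V -> F2}) z : B \in pffun_on (0%R : F2) Z predT -> z \notin Z -> B z = 0.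
  by case/pffun_onP=> /supportP supB _; apply: supB.
exists (P \- Q); split.
- move=> k lt_dk; rewrite coefsB; move/ffunP/(_ k): eqf.
  by rewrite !ffunE inE lt_dk => ->; rewrite subrr.
- by move=> z nZz /=; rewrite !vanish ?subrr.
- apply/existsP; rewrite -negb_forall; apply: contraNN neQP => /forallP eqPQ.
  by apply/eqP/ffunP => z; apply/esym/eqP; rewrite -subr_eq0 eqPQ.
Qed.

(** Among the polynomials of degree at most [d] vanishing off [S], one with the
    largest support works: if it vanished at too many points of [S], a nonzero
    polynomial supported at these points could be added to it. *)
Lemma exists_large_support d (S : {set V}) :
  exists c : V -> F2, [/\ deg_le d c, forall z, z \notin S -> peval c z = 0
    & (#|[set z in S | (peval c z == 0)%R]| <= #|[set k : V | d < weight k]|)%N].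
Proof.
pose good (P : {ffun V -> F2}) :=
  [forall k, (d < weight k)%N ==> (coefs P k == 0)]
  && [forall z, (z \notin S) ==> (P z == 0)].
pose supp (P : {ffun V -> F2}) := [set z | P z != 0].
have good0 : good 0.
  apply/andP; split; apply/forallP => z; apply/implyP => _; last by rewrite ffunE.
  by rewrite /coefs big1 // => a _; rewrite ffunE mul0r.
case: (arg_maxnP (fun P => #|supp P|) good0) => P /andP[/forallP degP /forallP offP] maxP.
exists (coefs P); split.
- by move=> k lt_dk; apply/eqP; apply: (implyP (degP k)).
- by move=> z nSz; rewrite peval_coefs; apply/eqP; apply: (implyP (offP z)).
set Z := [set z in S | _]; rewrite leqNgt; apply/negP.
case/exists_small_support => Q [degQ offQ [z0 Qz0]].
have PZ z : z \in Z -> P z = 0 by rewrite inE peval_coefs => /andP[_ /eqP].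
have Zz0 : z0 \in Z by apply: contraNT Qz0 => /offQ->.
have /maxP /=: good [ffun z => P z + Q z].
  apply/andP; split; apply/forallP => k; apply/implyP => lt_dk.
    have ->: coefs [ffun z => P z + Q z] k = coefs P k + coefs Q k.
      by rewrite -big_split; apply: eq_bigr => a _; rewrite ffunE mulrDl.
    by rewrite (eqP (implyP (degP k) lt_dk)) degQ ?addr0.
  rewrite ffunE (eqP (implyP (offP k) lt_dk)) offQ ?addr0 //.
  by apply: contra lt_dk; rewrite inE => /andP[].
rewrite leqNgt => /negP; apply; apply/proper_card/properP; split.
  apply/subsetP => z; rewrite !inE ffunE => Pz.
  by rewrite offQ ?addr0 //; apply: contra Pz => /PZ->.
by exists z0; rewrite !inE ?ffunE PZ ?add0r ?eqxx.
Qed.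

(** The Croot-Lev-Pach splitting: in a product of two monomials of total degree
    at most [2 * s], one factor has degree at most [s].  The first sum collects
    the terms whose factor in [u] is such, the second one the others. *)
Lemma peval_add_split c s u v : deg_le (2 * s) c ->
  peval c (u + v) = \sum_(i | (weight i <= s)%N) monom i u *
     (\sum_(k | lev i k) c k * monom (subv k i) v) +
   \sum_(j | (weight j <= s)%N)
     (\sum_(i | (s < weight i)%N)
        \sum_(k | lev i k && (subv k i == j)) c k * monom i u) * monom j v.
Proof.
move=> deg_c; rewrite /peval; under eq_bigr do rewrite monomD mulr_sumr.
rewrite (exchange_big_dep xpredT) //= (bigID (fun i => (weight i <= s)%N)) /=.
congr (_ + _).
  apply: eq_bigr => i _; rewrite mulr_sumr; apply: eq_bigr => k _.
  by rewrite mulrCA.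
under [RHS]eq_bigr do rewrite mulr_suml.
rewrite [RHS]exchange_big /=; apply: eq_big => [i|i lt_si]; first by rewrite ltnNge.
under [RHS]eq_bigr do rewrite mulr_suml.
rewrite [RHS](exchange_big_dep (lev i)) /=; last by move=> j k _ /andP[].
apply: eq_bigr => k le_ik; rewrite le_ik /=.
have [lt_sk | le_ks] := ltnP (2 * s) (weight k).
  by rewrite deg_c // mul0r big1 // => j _; rewrite !mul0r.
rewrite (big_pred1 (subv k i)) ?mulrA // => j /=; rewrite [RHS]eq_sym.
case: eqP => [<-|_]; rewrite ?andbF // andbT.
by move: lt_si le_ks; rewrite (weight_subv le_ik); lia.
Qed.

End Polynomials.

(** The matrix factors through [T], hence has rank at most [#|T|]; being diagonal
    with nonzero diagonal entries, it has rank [#|D|]. *)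
Lemma diag_card (F : fieldType) (D T : finType) (f : D -> T -> F) (g : T -> D -> F) :
  (forall u v, (\sum_t f u t * g t v == 0) = (u != v)) -> (#|D| <= #|T|)%N.
Proof.
move=> diag.
pose M : 'M[F]_(#|D|, #|T|) := \matrix_(a, t) f (enum_val a) (enum_val t).
pose N : 'M[F]_(#|T|, #|D|) := \matrix_(t, a) g (enum_val t) (enum_val a).
pose dg u := \sum_t f u t * g t u.
have MN : M *m N = diag_mx (\row_a dg (enum_val a)).
  apply/matrixP => a b; rewrite !mxE.
  transitivity (\sum_t f (enum_val a) t * g t (enum_val b)).
    rewrite (reindex (@enum_val T T)) /=; last exact/onW_bij/enum_val_bij.
    by apply: eq_bigr => t _; rewrite !mxE.
  case: eqP => [->|neq_ab]; first by rewrite mulr1n.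
  by apply/eqP; rewrite mulr0n diag (inj_eq enum_val_inj); apply/eqP.
have <-: \rank (M *m N) = #|D|.
  apply/eqP; rewrite -/(row_free _) row_free_unit MN unitmxE det_diag unitfE.
  apply/prodf_neq0 => a _; rewrite mxE /dg.
  by have := diag (enum_val a) (enum_val a); rewrite eqxx /= => ->.
by rewrite (leq_trans (mulmx_max_rank M N)).
Qed.

(** * Croot-Lev-Pach rank bound *)

Section Rank.
Variables (I : finType) (p : nat).
Local Notation q := p.+1.
Hypothesis triv_q : pascal_trivial q.
Local Notation V := {ffun I -> 'I_q}.

(** The functions of degree at most [s], restricted to [D], span a space of
    dimension at most [r].  A spanning family is asked for, instead of a
    dimension, since this is what the factorization in [diag_card] uses. *)
Definition spanned (s : nat) (D : {set V}) (r : nat) : Prop :=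
  exists (J : finType) (alpha : J -> V -> F2) (beta : V -> J -> F2),
    (#|J| <= r)%N /\
    forall (i u : V), (weight i <= s)%N -> u \in D ->
      monom i u = \sum_t beta i t * alpha t u.

Lemma spanned_sub s (D D' : {set V}) r :
  D' \subset D -> spanned s D r -> spanned s D' r.
Proof.
move=> /subsetP sD'D [J [alpha [beta [le_Jr spanD]]]].
by exists J, alpha, beta; split=> // i u le_is /sD'D; apply: spanD.
Qed.

Lemma spanned_monom s (D : {set V}) :
  spanned s D #|[set k : V | (weight k <= s)%N]|.
Proof.
set B := [set k | _].
exists {k | k \in B}, (fun t u => monom (val t) u), (fun i t => (val t == i)%:R).
split=> [|i u le_is _]; first by rewrite card_sig.
have Bi : i \in B by rewrite inE.
rewrite (bigD1 (exist _ i Bi)) //= eqxx mul1r big1 ?addr0 // => t.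
by rewrite -val_eqE /= => /negbTE->; rewrite mul0r.
Qed.

(** Each of the two sums of [peval_add_split] factors through the spanning
    family of [spanned], whence the factor [2]. *)
Lemma diag_set_card (s r : nat) (c : V -> F2) (h : V) (D : {set V}) :
    deg_le (2 * s) c -> spanned s D r ->
    (forall u v, u \in D -> v \in D -> (peval c (u + v + h) == 0) = (u != v)) ->
  (#|D| <= 2 * r)%N.
Proof.
move=> deg_c [J [alpha [beta [le_Jr spanD]]]] diagD.
have deg_ch := deg_le_translate h deg_c.
set c' := translate c h in deg_ch.
pose B i v := \sum_(k | lev i k) c' k * monom (subv k i) v.
pose C j u := \sum_(i : V | (s < weight i)%N)
  \sum_(k | lev i k && (subv k i == j)) c' k * monom i u.
pose f (u : {u | u \in D}) (t : J + J) :=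
  match t with inl t => alpha t (val u)
  | inr t => \sum_(j | (weight j <= s)%N) C j (val u) * beta j t end.
pose g (t : J + J) (v : {u | u \in D}) :=
  match t with inl t => \sum_(i | (weight i <= s)%N) beta i t * B i (val v)
  | inr t => alpha t (val v) end.
suff /diag_card: forall u v, (\sum_t f u t * g t v == 0) = (u != v).
  rewrite card_sig card_sum addnn -mul2n => /leq_trans-> //.
  by rewrite leq_mul2l.
move=> [u Du] [v Dv].
have ->: (exist (fun x => x \in D) u Du != exist _ v Dv) = (u != v).
  by rewrite -val_eqE.
rewrite -diagD // -(peval_translate triv_q).
rewrite (peval_add_split triv_q _ _ deg_ch) big_sumType /=.
congr (_ == _). congr (_ + _).
  under eq_bigr do rewrite mulr_sumr.
  rewrite exchange_big /=; apply: eq_bigr => i le_is.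
  rewrite spanD // mulr_suml; apply: eq_bigr => t _.
  by rewrite mulrA [alpha t u * _]mulrC.
under eq_bigr do rewrite mulr_suml.
rewrite exchange_big /=; apply: eq_bigr => j le_js.
rewrite [monom j v]spanD // mulr_sumr; apply: eq_bigr => t _.
by rewrite mulrA.
Qed.

End Rank.

Section TwoDigits.
Variable I : finType.
Local Notation V2 := {ffun I -> 'I_2}.
Local Notation V4 := {ffun I -> 'I_4}.

Definition lo (u : V4) : V2 := [ffun l => inord (u l %% 2)].
Definition hi (u : V4) : V2 := [ffun l => inord (u l %/ 2)].

(** The case of Lucas' theorem for two binary digits. *)
Lemma lucas2 (u i : nat) : (u < 4)%N -> (i < 4)%N ->
  'C(u, i)%:R = 'C(u %% 2, i %% 2)%:R * 'C(u %/ 2, i %/ 2)%:R :> F2.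
Proof.
move=> lt_u lt_i; apply/val_inj; move: u i lt_u lt_i.
by case=> [|[|[|[|u]]]] [|[|[|[|i]]]].
Qed.

Lemma monom_lo_hi (i u : V4) : monom i u = monom (lo i) (lo u) * monom (hi i) (hi u).
Proof.
rewrite -big_split /=; apply: eq_bigr => l _.
by rewrite lucas2 // !ffunE !inordK // ?ltn_mod // ltn_divLR.
Qed.

(** A monomial is the product of a monomial in the lower bits and one in the
    upper bits.  If the latter has degree at most [s1], the former is
    written as a combination of the indicators of the at most [tau] values which the
    lower bits take on [D]; the other monomials are kept as they are.  This
    improves on [spanned_monom] when [tau] is smaller than the number of
    monomials in the lower bits. *)
Lemma spanned_lo_hi (s s1 tau : nat) (D : {set V4}) :
    (#|lo @: D| <= tau)%N ->
  spanned s D (tau * #|[set k : V2 | (weight k <= s1)%N]|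
     + #|[set k : V4 | (weight k <= s)%N && (s1 < weight (hi k))%N]|)%N.
Proof.
set B := [set k | _]; set C := [set k | _] => le_tau.
pose J := ({t | t \in lo @: D} * {k | k \in B} + {k | k \in C})%type.
pose alpha (j : J) (u : V4) := match j with
  | inl (t, k) => (val t == lo u)%:R * monom (val k) (hi u)
  | inr k => monom (val k) u end.
pose beta (i : V4) (j : J) : F2 := match j with
  | inl (t, k) => (val k == hi i)%:R * monom (lo i) (val t)
  | inr k => (val k == i)%:R *+ (s1 < weight (hi i))%N end.
exists J, alpha, beta; split.
  by rewrite card_sum card_prod !card_sig leq_add2r leq_mul2r le_tau orbT.
move=> i u le_is Du; rewrite big_sumType /=.
have [le_s1 | lt_s1] := leqP (weight (hi i)) s1.
  rewrite [X in _ = _ + X]big1 ?addr0; last by move=> k _; rewrite mulr0n mul0r.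
  have Dlo : lo u \in lo @: D by apply: imset_f.
  have Bhi : hi i \in B by rewrite inE.
  rewrite (bigD1 (exist (fun t => t \in lo @: D) _ Dlo,
                  exist (fun k => k \in B) _ Bhi)) //= !eqxx !mul1r monom_lo_hi.
  rewrite big1 ?addr0 // => -[[t Dt] [k Bk]] /=.
  rewrite xpair_eqE -!val_eqE /= negb_and.
  by case/orP=> /negbTE->; rewrite ?mul0r ?mulr0.
have Ci : i \in C by rewrite inE le_is.
rewrite [X in _ = X + _]big1 ?add0r; last first.
  move=> [t [k Bk]] _ /=; case: eqP => [ek|_]; last by rewrite !mul0r.
  by move: Bk; rewrite ek inE leqNgt lt_s1.
rewrite (bigD1 (exist _ i Ci)) //= eqxx mul1r big1 ?addr0 // => k.
by rewrite -val_eqE /= => /negbTE->; rewrite mul0r.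
Qed.

End TwoDigits.

(** * Binary digits of vectors over C_8 *)

Section CyclicEight.
Variable I : finType.
Local Notation V2 := {ffun I -> 'I_2}.
Local Notation V4 := {ffun I -> 'I_4}.
Local Notation V8 := {ffun I -> 'I_8}.
Implicit Types x y z : V8.

Definition par x : V2 := [ffun l => inord (x l %% 2)].
Definition bit1 x : V2 := [ffun l => inord (x l %/ 2 %% 2)].
Definition bit2 x : V2 := [ffun l => inord (x l %/ 4)].
Definition halfv x : V4 := [ffun l => inord (x l %/ 2)].
Definition mod4 x : V4 := [ffun l => inord (x l %% 4)].
Definition up (g : V2) : V4 := [ffun l => inord (g l)].

Lemma parE x l : par x l = (x l %% 2)%N :> nat.
Proof. by rewrite ffunE inordK // ltn_mod. Qed.
Lemma bit1E x l : bit1 x l = (x l %/ 2 %% 2)%N :> nat.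
Proof. by rewrite ffunE inordK // ltn_mod. Qed.
Lemma bit2E x l : bit2 x l = (x l %/ 4)%N :> nat.
Proof. by rewrite ffunE inordK // ltn_divLR. Qed.
Lemma halfE x l : halfv x l = (x l %/ 2)%N :> nat.
Proof. by rewrite ffunE inordK // ltn_divLR. Qed.
Lemma mod4E x l : mod4 x l = (x l %% 4)%N :> nat.
Proof. by rewrite ffunE inordK // ltn_mod. Qed.
Lemma upE g l : up g l = g l :> nat.
Proof. by rewrite ffunE inordK // (leq_trans (ltn_ord _)). Qed.
Lemma lo_half x : lo (halfv x) = bit1 x.
Proof.
apply/ffunP=> l; apply: val_inj.
by rewrite /= bit1E ffunE halfE inordK // ltn_mod.
Qed.

Lemma ffun_val_inj q (f g : {ffun I -> 'I_q}) : (forall l, f l = g l :> nat) -> f = g.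
Proof. by move=> fg; apply/ffunP=> l; apply: val_inj; apply: fg. Qed.

Lemma ffun_valP q (f g : {ffun I -> 'I_q}) l : f = g -> f l = g l :> nat.
Proof. by move=> ->. Qed.

Lemma ffun_valD q (f g : {ffun I -> 'I_q.+1}) l :
  (f + g) l = ((f l + g l) %% q.+1)%N :> nat.
Proof. by rewrite ffunE. Qed.

Lemma par_half_inj x y : par x = par y -> halfv x = halfv y -> x = y.
Proof.
move=> ep eh; apply: ffun_val_inj => l.
move: (ffun_valP l ep) (ffun_valP l eh); rewrite !parE !halfE; lia.
Qed.

Lemma mod4_bit2_inj x y : mod4 x = mod4 y -> bit2 x = bit2 y -> x = y.
Proof.
move=> ep eh; apply: ffun_val_inj => l.
move: (ffun_valP l ep) (ffun_valP l eh); rewrite !mod4E !bit2E; lia.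
Qed.

Lemma mod4_eq x y : mod4 x = mod4 y <-> par x = par y /\ bit1 x = bit1 y.
Proof.
split=> [e | [ep eb]]; last first.
  apply: ffun_val_inj => l; move: (ffun_valP l ep) (ffun_valP l eb).
  by rewrite !parE !bit1E !mod4E; lia.
by split; apply: ffun_val_inj => l; move: (ffun_valP l e);
  rewrite ?parE ?bit1E !mod4E; lia.
Qed.

Lemma half_double x : halfv x + halfv x + up (par x) = mod4 x.
Proof.
apply: ffun_val_inj => l; rewrite !ffun_valD halfE upE parE mod4E; lia.
Qed.

(** Writing [x = par x + 2 * halfv x], and likewise for [y], shows that [x + y]
    is twice the vector on the left; and [2 * z] depends only on [z] modulo
    [4]. *)
Lemma half_midpoint x y z : par x = par y ->
  halfv x + halfv y + up (par x) = mod4 z -> x + y = z + z.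
Proof.
move=> ep em; apply: ffun_val_inj => l.
move: (ffun_valP l ep) (ffun_valP l em).
rewrite !ffun_valD !halfE upE !parE mod4E; lia.
Qed.

Lemma bit2_double x : bit2 x + bit2 x = 0.
Proof. by apply: ffun_val_inj => l; rewrite ffun_valD bit2E ffunE /=; lia. Qed.

(** As [2 * x] only depends on [x] modulo [4], [x + y] is twice
    [x + 2 * (bit2 x + bit2 y)], whose [bit1] is [bit1 x + bit2 x + bit2 y]. *)
Lemma bit2_midpoint x y z : mod4 x = mod4 y -> par x = par z ->
  bit2 x + bit2 y + bit1 x = bit1 z -> x + y = z + z.
Proof.
move=> ep eq em; apply: ffun_val_inj => l.
move: (ffun_valP l ep) (ffun_valP l eq) (ffun_valP l em).
rewrite !ffun_valD !bit1E !bit2E !mod4E !parE; lia.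
Qed.

End CyclicEight.

(** * Cutting a progression-free set by fibre size *)

Lemma card_fibres (T U : finType) (f : T -> U) (A : {set T}) (B : {set U}) (K : nat) :
    (forall x, x \in A -> f x \in B) ->
    (forall t, t \in B -> (#|[set x in A | f x == t]| <= K)%N) ->
  (#|A| <= #|B| * K)%N.
Proof.
move=> fAB fibK; rewrite -sum1_card (partition_big f (mem B)) //=.
rewrite -sum_nat_const; apply: leq_sum => t /fibK; apply: leq_trans.
by rewrite -sum1_card; apply: eq_leq; apply: eq_bigl => x; rewrite inE.
Qed.

Section CyclicEight.
Variable I : finType.
Local Notation V2 := {ffun I -> 'I_2}.
Local Notation V4 := {ffun I -> 'I_4}.
Local Notation V8 := {ffun I -> 'I_8}.
Implicit Types x y z : V8.

(** Equivalent to the absence of nontrivial progressions [a, b, c]: if two of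
    the three elements are equal and [a + c = b + b], then either [a = c] or
    all three are equal.  This form is the one inherited by powers. *)
Definition ap_free (A : {set V8}) :=
  forall a b c, a \in A -> b \in A -> c \in A -> a + c = b + b -> a = c.

Definition fibre (A : {set V8}) (t : V4) := [set x in A | mod4 x == t].

Definition low2 (E : nat) := #|[set k : V2 | (weight k <= E)%N]|.
Definition high2 (E : nat) := #|[set k : V2 | (E < weight k)%N]|.
Definition low4 (E : nat) := #|[set k : V4 | (weight k <= E)%N]|.
Definition high4 (E : nat) := #|[set k : V4 | (E < weight k)%N]|.
Definition low4_high2 (E E' : nat) :=
  #|[set k : V4 | (weight k <= E)%N && (E' < weight (hi k))%N]|.

Definition rich (A : {set V8}) (K : nat) (g : V2) : {set V2} :=
  [set bit1 x | x in A & (par x == g) && (K < #|fibre A (mod4 x)|)%N].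

(** Were there more rich residues, some polynomial of degree at most [2 * E] in
    [bit1], vanishing off them, would be nonzero at one of them, say [s].  For [x]
    and [y] in the fibre of [s], [bit2 x + bit2 y + s] is the [bit1] of a
    midpoint; so the values of the polynomial there form a diagonal matrix with
    nonzero diagonal, and the fibre has at most [2 * low2 E] elements. *)
Lemma card_rich A E g : ap_free A -> (#|rich A (2 * low2 E) g| <= high2 (2 * E))%N.
Proof.
move=> freeA; set S := rich _ _ _; rewrite leqNgt; apply/negP => lt_S.
have [c [deg_c offS zeroS]] := exists_large_support pascal_trivial2 (2 * E) S.
have [s Ss nz_s]: exists2 s, s \in S & peval c s != 0.
  apply/exists_inP; apply: contraTT lt_S => /exists_inPn all0.
  rewrite -leqNgt (leq_trans _ zeroS) //; apply/subset_leq_card/subsetP => s Ss.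
  by rewrite inE Ss; apply: contraTT (all0 s Ss) => ->.
have /imsetP[x] := Ss; rewrite !inE => /and3P[Ax /eqP parx rich_x] def_s.
pose D := @bit2 I @: fibre A (mod4 x).
have cardD : #|D| = #|fibre A (mod4 x)|.
  apply: card_in_imset => y z; rewrite !inE => /andP[_ /eqP ey] /andP[_ /eqP ez].
  by apply: mod4_bit2_inj; rewrite ey ez.
have: (#|D| <= 2 * low2 E)%N.
  apply: (diag_set_card pascal_trivial2 (h := s) deg_c (spanned_monom E D)).
  move=> _ _ /imsetP[y Dy ->] /imsetP[z Dz ->].
  move: Dy Dz; rewrite !inE => /andP[Ay /eqP ey] /andP[Az /eqP ez].
  have [<-|neq_yz] /= := eqVneq (bit2 y).
    by rewrite bit2_double add0r (negbTE nz_s).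
  apply/eqP/offS; apply: contra neq_yz => /imsetP[w].
  rewrite !inE => /and3P[Aw /eqP parw _] em; apply/eqP; congr (@bit2 I _).
  have [/mod4_eq[epy eby] /mod4_eq[epz _]] := (ey, ez).
  apply: (freeA y w z) => //; apply: bit2_midpoint; first by rewrite ey ez.
    by rewrite epy parx parw.
  by rewrite eby -def_s em.
by rewrite cardD leqNgt rich_x.
Qed.

(** Take a polynomial of degree at most [2 * D] with large support in the
    residues of [A'] modulo [4].  Elements of [A'] above its zeros are few
    because the fibres are small, and in each of the [2 ^ #|I|] parity classes
    the remaining ones index a diagonal matrix of rank at most [2 * r]. *)
Lemma card_band (A A' : {set V8}) K D r : ap_free A -> A' \subset A ->
    (forall t, #|fibre A' t| <= K)%N ->
    (forall g, spanned D (@halfv I @: [set x in A' | par x == g]) r) ->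
  (#|A'| <= high4 (2 * D) * K + 2 ^ #|I| * (2 * r))%N.
Proof.
move=> freeA /subsetP sA'A le_fib span_r.
pose S := @mod4 I @: A'.
have [c [deg_c offS zeroS]] := exists_large_support pascal_trivial4 (2 * D) S.
pose A0 := [set x in A' | peval c (mod4 x) == 0].
rewrite -(cardsID A0) leq_add //.
  apply: leq_trans (leq_mul zeroS (leqnn K)).
  apply: (card_fibres (f := @mod4 I)) => [x | t _].
    rewrite !inE => /andP[_ /andP[A'x zx]].
    by rewrite zx andbT imset_f.
  apply: leq_trans (le_fib t); apply/subset_leq_card/subsetP => x.
  by rewrite !inE -andbA => /andP[-> /andP[_ ->]].
have ->: (2 ^ #|I| = #|[set: V2]|)%N by rewrite cardsT card_ffun card_ord.
apply: (card_fibres (f := @par I)) => [x | g _]; first by rewrite inE.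
set X := [set x in _ | _].
have sX : X \subset [set x in A' | par x == g].
  by apply/subsetP => x; rewrite !inE -andbA => /and3P[_ -> ->].
have XP x : x \in X -> [/\ x \in A', peval c (mod4 x) != 0 & par x = g].
  by rewrite !inE => /andP[/andP[nz A'x] /eqP ->]; split; move: nz; rewrite ?A'x.
have <-: #|@halfv I @: X| = #|X|.
  apply: card_in_imset => x y /XP[_ _ ex] /XP[_ _ ey].
  by apply: par_half_inj; rewrite ex ey.
apply: (diag_set_card pascal_trivial4 (h := up g) deg_c).
  exact: spanned_sub (imsetS _ sX) (span_r g).
move=> _ _ /imsetP[x /XP[A'x nz_x ex] ->] /imsetP[y /XP[A'y _ ey] ->].
have [<-|neq_xy] /= := eqVneq (halfv x).
  by rewrite -ex half_double (negbTE nz_x).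
apply/eqP/offS; apply: contra neq_xy => /imsetP[z A'z em]; apply/eqP.
congr (@halfv I _); apply: (freeA x z y); try exact: sA'A.
by apply: half_midpoint; rewrite ?ex ?ey.
Qed.

Lemma lo_half_rich (A A' : {set V8}) K g : A' \subset A ->
    (forall x, x \in A' -> (K < #|fibre A (mod4 x)|)%N) ->
  @lo I @: (@halfv I @: [set x in A' | par x == g]) \subset rich A K g.
Proof.
move=> /subsetP sA'A richA'; apply/subsetP => _ /imsetP[_ /imsetP[x Xx ->] ->].
move: Xx; rewrite inE lo_half => /andP[A'x px]; apply: imset_f.
by rewrite !inE sA'A ?px ?richA'.
Qed.

Lemma card_bit12 (X : {set V8}) (g : V2) (s : V2) :
  (#|[set x in [set y in X | par y == g] | bit1 x == s]| <= 2 ^ #|I|)%N.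
Proof.
set Y := [set x in _ | _].
have <-: #|@bit2 I @: Y| = #|Y|.
  apply: card_in_imset => x y; rewrite !inE.
  move=> /andP[/andP[_ /eqP px] /eqP bx] /andP[/andP[_ /eqP py] /eqP by_].
  by apply: mod4_bit2_inj; apply/mod4_eq; rewrite px py bx by_.
by rewrite (leq_trans (max_card _)) // card_ffun card_ord.
Qed.

(** The three lines bound the numbers of elements in small, medium and large
    fibres, the thresholds being [2 * low2 E1] and [2 * low2 E2].  Elements of
    medium fibres have at most [high2 (2 * E1)] values of [bit1] in each parity
    class, by [card_rich], so that [spanned_lo_hi] applies. *)
Lemma card_ap_free A E1 D1 E2 D2 s : ap_free A ->
  (#|A| <= high4 (2 * D1) * (2 * low2 E1) + 2 ^ #|I| * (2 * low4 D1)
    + (high4 (2 * D2) * (2 * low2 E2)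
       + 2 ^ #|I| * (2 * (high2 (2 * E1) * low2 s + low4_high2 D2 s)))
    + 2 ^ #|I| * (high2 (2 * E2) * 2 ^ #|I|))%N.
Proof.
move=> freeA.
pose fib x := #|fibre A (mod4 x)|.
pose A1 := [set x in A | fib x <= 2 * low2 E1]%N.
pose A3 := [set x in A | 2 * low2 E2 < fib x]%N.
pose A2 := [set x in A | 2 * low2 E1 < fib x <= 2 * low2 E2]%N.
have sub1 : A1 \subset A by apply/subsetP => x; rewrite inE => /andP[].
have sub2 : A2 \subset A by apply/subsetP => x; rewrite inE => /andP[].
have sub3 : A3 \subset A by apply/subsetP => x; rewrite inE => /andP[].
have fib_le (A' : {set V8}) K : A' \subset A -> (forall x, x \in A' -> fib x <= K)%N ->
  forall t, (#|fibre A' t| <= K)%N.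
  move=> sA' leK t; have [->|[x]] := set_0Vmem (fibre A' t); first by rewrite cards0.
  rewrite inE => /andP[A'x /eqP <-]; apply: leq_trans (leK x A'x).
  by apply/subset_leq_card/subsetP => y; rewrite !inE => /andP[/(subsetP sA')-> ->].
have: (#|A| <= #|A1| + #|A2| + #|A3|)%N.
  rewrite -(cardsID A1) -addnA leq_add ?subset_leq_card ?subsetIr //.
  rewrite -(cardsID A2) leq_add ?subset_leq_card ?subsetIr //.
  apply/subsetP => x; rewrite !inE.
  by move: (x \in A) (fib x) => inA f; lia.
move/leq_trans; apply; rewrite !leq_add //.
- apply: (card_band freeA sub1) => [|g]; last exact: spanned_monom.
  by apply: fib_le => // x; rewrite inE => /andP[].
- apply: (card_band freeA sub2) => [|g].
    by apply: fib_le => // x; rewrite inE => /and3P[].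
  apply: spanned_lo_hi; apply: leq_trans (card_rich E1 g freeA).
  by apply/subset_leq_card/lo_half_rich => // x; rewrite inE => /and3P[].
have eq2: (2 ^ #|I| = #|[set: V2]|)%N by rewrite cardsT card_ffun card_ord.
rewrite [X in (X * _)%N]eq2.
apply: (card_fibres (f := @par I)) => [x | g _]; first by rewrite inE.
apply: leq_trans (leq_mul (card_rich E2 g freeA) (leqnn _)).
apply: (card_fibres (f := @bit1 I)) => [x | t _]; last exact: card_bit12.
rewrite !inE => /andP[/andP[Ax lt_x] px].
by apply: imset_f; rewrite !inE Ax px.
Qed.

End CyclicEight.

(** * Counting monomials *)

Local Open Scope nat_scope.

(** Expand the power of the sum: the product over [l] of [c (k l)] is the term
    of index [k].  With [c j = x ^ (p - j) * y ^ j] this is the exponential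
    moment bound for the number of exponents of given weight. *)
Lemma weighted_count (I : finType) (q M : nat) (c : 'I_q -> nat)
    (S : {set {ffun I -> 'I_q}}) :
  (forall k, k \in S -> M <= \prod_l c (k l)) -> #|S| * M <= (\sum_j c j) ^ #|I|.
Proof.
move=> le_M; rewrite -sum_nat_const.
have ->: (\sum_j c j) ^ #|I| = \prod_(l : I) \sum_j c j by rewrite prod_nat_const.
rewrite bigA_distr_bigA [leqRHS](bigID (mem S)) /=.
by rewrite (leq_trans _ (leq_addr _ _)) ?leq_sum.
Qed.

Section Counting.
Variables (I : finType) (p : nat).
Local Notation V := {ffun I -> 'I_p.+1}.

Lemma weight_le (k : V) : weight k <= p * #|I|.
Proof.
rewrite mulnC -sum_nat_const; apply: leq_sum => l _.
by rewrite -ltnS.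
Qed.

Lemma prod_expn_weight x y (k : V) :
  \prod_l (x ^ (p - k l) * y ^ k l) = x ^ (p * #|I| - weight k) * y ^ weight k.
Proof.
rewrite big_split /= -!expn_sum; congr (x ^ _ * _).
have: weight k + \sum_l (p - k l) = p * #|I|.
  rewrite -big_split /= mulnC -sum_nat_const; apply: eq_bigr => l _.
  by rewrite subnKC // -ltnS.
by move=> <-; rewrite addKn.
Qed.

End Counting.

Lemma leq_expn_base x y e : x <= y -> x ^ e <= y ^ e.
Proof. by case: e => // e le_xy; rewrite leq_exp2r. Qed.

Lemma leq_expn_shift x y a b c : x <= y -> a <= b <= c ->
  x ^ (c - a) * y ^ a <= x ^ (c - b) * y ^ b.
Proof.
move=> le_xy /andP[le_ab le_bc].
have ->: c - a = c - b + (b - a) by lia.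
rewrite expnD -mulnA -[in y ^ b](subnK le_ab) expnD.
by rewrite leq_mul2l leq_mul2r leq_expn_base ?orbT.
Qed.

Section Rates.
Variables (I : finType) (N m : nat).
Hypothesis cardI : #|I| = N * m.

Lemma expn_split x y p D :
  (x ^ (p * N - D) * y ^ D) ^ m = x ^ (p * #|I| - D * m) * y ^ (D * m).
Proof. by rewrite expnMn -!expnM cardI mulnBl !mulnA. Qed.

Lemma count_high p D x y S : x <= y -> D <= p * N ->
    \sum_(j < p.+1) x ^ (p - j) * y ^ j = S ->
  #|[set k : {ffun I -> 'I_p.+1} | D * m < weight k]|
    * (x ^ (p * N - D) * y ^ D) ^ m <= (S ^ N) ^ m.
Proof.
move=> le_xy le_D <-; rewrite -expnM -cardI expn_split.
apply: weighted_count => k; rewrite inE => /ltnW lt_D.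
by rewrite prod_expn_weight leq_expn_shift // lt_D weight_le.
Qed.

Lemma count_low p D x y S : y <= x -> D <= p * N ->
    \sum_(j < p.+1) x ^ (p - j) * y ^ j = S ->
  #|[set k : {ffun I -> 'I_p.+1} | weight k <= D * m]|
    * (x ^ (p * N - D) * y ^ D) ^ m <= (S ^ N) ^ m.
Proof.
move=> le_yx le_D <-; rewrite -expnM -cardI expn_split.
apply: weighted_count => k; rewrite inE => le_kD.
have le_Dm : D * m <= p * #|I| by rewrite cardI mulnA leq_mul2r le_D orbT.
rewrite prod_expn_weight mulnC [leqRHS]mulnC.
rewrite -{1}(subKn le_Dm) -{1}(subKn (weight_le k)) leq_expn_shift //.
by rewrite leq_sub2l //= leq_subr.
Qed.

(** The weights [2 ^ - j] control the degree from above, and the extra factor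
    [2 ^ (j %/ 2)] the degree in the upper bits from below. *)
Lemma count_low4_high2 D s : D <= 3 * N ->
  low4_high2 I (D * m) (s * m) * (2 ^ (3 * N - D) * 2 ^ s) ^ m <= (18 ^ N) ^ m.
Proof.
move=> le_D; rewrite -[(18 ^ N) ^ m]expnM -cardI.
have ->: 18 = \sum_(j < 4) 2 ^ (3 - j) * 1 ^ j * 2 ^ (j %/ 2).
  by rewrite !big_ord_recl big_ord0.
apply: weighted_count => k; rewrite inE => /andP[le_kD lt_sk].
have ->: \prod_l (2 ^ (3 - k l) * 1 ^ k l * 2 ^ (k l %/ 2))
  = 2 ^ (3 * #|I| - weight k) * 2 ^ weight (hi k).
  rewrite big_split /= prod_expn_weight exp1n muln1 -expn_sum.
  congr (_ * 2 ^ _); apply: eq_bigr => l _.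
  by rewrite ffunE inordK // ltn_divLR.
rewrite expnMn -!expnM mulnBl -mulnA -cardI.
by apply: leq_mul; rewrite leq_exp2l ?leq_sub2l ?(ltnW lt_sk).
Qed.

End Rates.

(** * Numerical bounds in dimension 136 m *)

Section RateArithmetic.
Variable m : nat.

Lemma rate_mul f1 Q1 P1 f2 Q2 P2 :
  f1 * Q1 ^ m <= P1 ^ m -> f2 * Q2 ^ m <= P2 ^ m ->
  f1 * f2 * (Q1 * Q2) ^ m <= (P1 * P2) ^ m.
Proof. by move=> le1 le2; rewrite !expnMn mulnACA leq_mul. Qed.

Lemma rate_trans f Q P a b :
  0 < Q -> f * Q ^ m <= P ^ m -> P * a <= Q * b -> f * a ^ m <= b ^ m.
Proof.
move=> Q_gt0 le_f le_ab; have Qm_gt0 : 0 < Q ^ m by rewrite expn_gt0 Q_gt0.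
rewrite -(leq_pmul2l Qm_gt0) mulnA [Q ^ m * f]mulnC -expnMn.
apply: leq_trans (leq_expn_base m le_ab).
by rewrite expnMn leq_mul2r le_f orbT.
Qed.

End RateArithmetic.

(** By Bernoulli's inequality, [(Y + 1) ^ m] exceeds any fixed multiple of
    [Y ^ m] when [m] is large. *)
Lemma leq_of_powers X Y C : (forall m, X ^ m <= C * Y ^ m) -> X <= Y.
Proof.
move=> le_pow; rewrite leqNgt; apply/negP => lt_YX.
have [Y0|Y_gt0] := posnP Y.
  by move: (le_pow 1) lt_YX; rewrite Y0 muln0 leqn0 expn1 => /eqP->.
have bern m : Y ^ m * (Y + m) <= X ^ m * Y.
  elim: m => [|m IHm]; first by rewrite addn0.
  rewrite !expnS -!mulnA (leq_trans (n := Y.+1 * (Y ^ m * (Y + m)))) //.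
    by rewrite mulnCA [leqRHS]mulnCA leq_mul2l; apply/orP; right; nia.
  by apply: leq_mul.
have := leq_trans (bern (C * Y)) (leq_mul (le_pow (C * Y)) (leqnn Y)).
rewrite mulnAC [leqRHS]mulnC leq_pmul2l ?expn_gt0 ?Y_gt0 //.
by rewrite -[leqRHS]add0n leq_add2r leqNgt Y_gt0.
Qed.

(** Numerals of natural numbers being unary, comparisons of large powers are
    moved to binary integers. *)
Ltac binary_compute := clear; Zify.zify; by vm_compute.

Lemma sum_rates X c a b h1 l1 f1 h2 l2 h3 l3 f3 h4 :
  X <= h1 * (2 * l1) + c * (2 * f1)
       + (h2 * (2 * l2) + c * (2 * (h3 * l3 + f3))) + c * (h4 * c) ->
  h1 * l1 * a <= b -> c * f1 * a <= b -> h2 * l2 * a <= b ->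
  c * (h3 * l3) * a <= b -> c * f3 * a <= b -> c * (h4 * c) * a <= b ->
  X * a <= 11 * b.
Proof.
move=> le_X b1 b2 b3 b4 b5 b6; apply: leq_trans (leq_mul le_X (leqnn a)) _.
lia.
Qed.

(** The dimension is [136 * m] so that the near-optimal thresholds are
    integral multiples of [m].  As fractions of the dimension, fibres change
    from small to medium at degree [46 / 136] and from medium to large at
    [51 / 136]; the polynomials have degree twice [130 / 136] on small fibres
    and twice [134 / 136] on medium ones; and [45 / 136] separates the degrees
    in the upper bits.  In the bounds below,
    the ratio of the two bases of a moment is close to the one
    that minimizes it; each of the six products of counts
    then has growth rate below [886 / 125] per dimension, by a margin of less
    than one part in a thousand for some of them. *)
Lemma card_ap_free_multiple (I : finType) (m : nat) (A : {set {ffun I -> 'I_8}}) :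
  #|I| = 136 * m -> ap_free A -> #|A| * 125 ^ #|I| <= 11 * 886 ^ #|I|.
Proof.
move=> cardI freeA.
have := card_ap_free (46 * m) (130 * m) (51 * m) (134 * m) (45 * m) freeA.
have [e1 e2]: 2 * (130 * m) = 260 * m /\ 2 * (134 * m) = 268 * m by rewrite !mulnA.
have [e3 e4]: 2 * (46 * m) = 92 * m /\ 2 * (51 * m) = 102 * m by rewrite !mulnA.
rewrite {}e1 {}e2 {}e3 {}e4 cardI !expnM.
have rate2 : (2 ^ 136) ^ m * 1 ^ m <= (2 ^ 136) ^ m by rewrite exp1n muln1.
have V46 : low2 I (46 * m) * (45 ^ 90 * 23 ^ 46) ^ m <= (68 ^ 136) ^ m.
  by apply: (count_low cardI); rewrite // !big_ord_recl big_ord0.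
have V51 : low2 I (51 * m) * (5 ^ 85 * 3 ^ 51) ^ m <= (8 ^ 136) ^ m.
  by apply: (count_low cardI); rewrite // !big_ord_recl big_ord0.
have V45 : low2 I (45 * m) * (91 ^ 91 * 45 ^ 45) ^ m <= (136 ^ 136) ^ m.
  by apply: (count_low cardI); rewrite // !big_ord_recl big_ord0.
have U92 : high2 I (92 * m) * (11 ^ 44 * 23 ^ 92) ^ m <= (34 ^ 136) ^ m.
  by apply: (count_high cardI); rewrite // !big_ord_recl big_ord0.
have U102 : high2 I (102 * m) * (1 ^ 34 * 3 ^ 102) ^ m <= (4 ^ 136) ^ m.
  by apply: (count_high cardI); rewrite // !big_ord_recl big_ord0.
have W130 : low4 I (130 * m) * (8 ^ 278 * 5 ^ 130) ^ m <= (1157 ^ 136) ^ m.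
  by apply: (count_low cardI); rewrite // !big_ord_recl big_ord0.
have W260 : high4 I (260 * m) * (5 ^ 148 * 7 ^ 260) ^ m <= (888 ^ 136) ^ m.
  by apply: (count_high cardI); rewrite // !big_ord_recl big_ord0.
have W268 : high4 I (268 * m) * (2 ^ 140 * 3 ^ 268) ^ m <= (65 ^ 136) ^ m.
  by apply: (count_high cardI); rewrite // !big_ord_recl big_ord0.
have W134 : low4_high2 I (134 * m) (45 * m) * (2 ^ 274 * 2 ^ 45) ^ m
    <= (18 ^ 136) ^ m.
  exact: (count_low4_high2 cardI).
have t1 : high4 I (260 * m) * low2 I (46 * m)
    * (125 ^ 136) ^ m <= (886 ^ 136) ^ m.
  by apply: (rate_trans _ (rate_mul W260 V46)); binary_compute.
have t2 : (2 ^ 136) ^ m * low4 I (130 * m)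
    * (125 ^ 136) ^ m <= (886 ^ 136) ^ m.
  by apply: (rate_trans _ (rate_mul rate2 W130)); binary_compute.
have t3 : high4 I (268 * m) * low2 I (51 * m)
    * (125 ^ 136) ^ m <= (886 ^ 136) ^ m.
  by apply: (rate_trans _ (rate_mul W268 V51)); binary_compute.
have t4 : (2 ^ 136) ^ m * (high2 I (92 * m) * low2 I (45 * m))
    * (125 ^ 136) ^ m <= (886 ^ 136) ^ m.
  by apply: (rate_trans _ (rate_mul rate2 (rate_mul U92 V45))); binary_compute.
have t5 : (2 ^ 136) ^ m * low4_high2 I (134 * m) (45 * m)
    * (125 ^ 136) ^ m <= (886 ^ 136) ^ m.
  by apply: (rate_trans _ (rate_mul rate2 W134)); binary_compute.
have t6 : (2 ^ 136) ^ m * (high2 I (102 * m) * (2 ^ 136) ^ m)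
    * (125 ^ 136) ^ m <= (886 ^ 136) ^ m.
  by apply: (rate_trans _ (rate_mul rate2 (rate_mul U102 rate2))); binary_compute.
move=> le_A; exact: (sum_rates le_A t1 t2 t3 t4 t5 t6).
Qed.

(** * Powers of progression-free sets *)

Section Tensor.
Variables (I : finType) (r : nat).
Local Notation V8 := {ffun I -> 'I_8}.
Local Notation W8 := {ffun I * 'I_r -> 'I_8}.

Definition slice (x : W8) (t : 'I_r) : V8 := [ffun i => x (i, t)].
Definition tensor (A : {set V8}) : {set W8} := [set x | [forall t, slice x t \in A]].

Lemma ap_free_tensor (A : {set V8}) : ap_free A -> ap_free (tensor A).
Proof.
move=> freeA a b c; rewrite !inE => /forallP Aa /forallP Ab /forallP Ac e.
apply/ffunP => -[i t]; have: slice a t = slice c t.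
  apply: (freeA _ (slice b t)) => //; apply/ffunP => l.
  by move/ffunP/(_ (l, t)): e; rewrite !ffunE.
by move/ffunP/(_ i); rewrite !ffunE.
Qed.

Lemma card_tensor (A : {set V8}) : #|A| ^ r <= #|tensor A|.
Proof.
pose glue (f : {ffun 'I_r -> V8}) : W8 := [ffun p => f p.2 p.1].
have sliceK f t : slice (glue f) t = f t by apply/ffunP => i; rewrite !ffunE.
have inj_glue : injective glue.
  by move=> f g e; apply/ffunP => t; rewrite -!sliceK e.
rewrite -[X in _ ^ X]card_ord -card_ffun_on -(card_image inj_glue).
apply/subset_leq_card/subsetP => _ /imageP[f /ffun_onP Af ->].
by rewrite inE; apply/forallP => t; rewrite sliceK.
Qed.

End Tensor.

Lemma leq_powers_of_tensor a T C c d n N m :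
  a ^ (N * m) <= T -> T * c ^ (n * (N * m)) <= C * d ^ (n * (N * m)) ->
  ((a * c ^ n) ^ N) ^ m <= C * ((d ^ n) ^ N) ^ m.
Proof.
move=> le_a; rewrite -!(expnM _ N) expnMn -!(expnM _ n).
by apply: leq_trans; rewrite leq_mul2r le_a orbT.
Qed.

(** The tensor power trick: the bound on the powers of [A] in dimensions
    divisible by [136] removes the constant [11] and the divisibility. *)
Lemma card_ap_free_cyclic8 (I : finType) (A : {set {ffun I -> 'I_8}}) :
  ap_free A -> #|A| * 125 ^ #|I| <= 886 ^ #|I|.
Proof.
move=> freeA; rewrite -(@leq_exp2r _ _ 136) //.
apply: (@leq_of_powers _ _ 11) => m.
apply: leq_powers_of_tensor (card_tensor (136 * m) A) _.
have cardI : #|{: I * 'I_(136 * m)}| = #|I| * (136 * m) by rewrite card_prod card_ord.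
have := card_ap_free_multiple (m := #|I| * m) _ (ap_free_tensor (r := 136 * m) freeA).
by rewrite cardI; apply; rewrite mulnCA.
Qed.

(** * From C_8 ^ J to the group G *)

Lemma progression_free_eq (gT : finGroupType) (A : {set gT}) (a b c : gT) :
    progression_free A -> a \in A -> b \in A -> c \in A ->
  (a * c = b ^+ 2)%g -> a = c.
Proof.
move=> freeA Aa Ab Ac e; apply/eqP/negPn/negP => neq_ac.
have /forall_inP/(_ a Aa)/forall_inP/(_ b Ab)/forall_inP/(_ c Ac) := freeA.
rewrite /nontrivial_3AP neq_ac e eqxx !andbT => /negP; apply.
apply/andP; split; apply: contraNneq neq_ac => eb.
  by move: e; rewrite expgS expg1 -eb => /mulgI->.
by move: e; rewrite expgS expg1 eb => /mulIg->.
Qed.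

(** Count the pairs of [x] in [G] and [v] with [x * phi v] in [A]: for
    fixed [v] there are [#|A|] of them, and for fixed [x] at most [(886 / 125) ^ #|J|]. *)
Lemma card_progression_free_cyclic8 (J : finType) (gT : finGroupType)
    (G : {group gT}) (A : {set gT}) (phi : {ffun J -> 'I_8} -> gT) :
    abelian G -> A \subset G -> progression_free A ->
    (forall u v, phi (u + v)%R = (phi u * phi v)%g) -> injective phi ->
    (forall v, phi v \in G) ->
  #|A| * 1000 ^ #|J| <= #|G| * 886 ^ #|J|.
Proof.
move=> abelG /subsetP sAG freeA phiD inj_phi phiG.
pose B x := [set v | (x * phi v)%g \in A].
have freeB x : x \in G -> ap_free (B x).
  move=> Gx a b c; rewrite !inE => Ba Bb Bc e; apply/inj_phi/(@mulgI _ x).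
  apply: (progression_free_eq freeA Ba Bb Bc).
  have comm v : (phi v * x = x * phi v)%g by apply: (centsP abelG).
  rewrite expgS expg1 -!mulgA; congr (x * _)%g.
  by rewrite !mulgA !comm -!mulgA -!phiD e.
have double : #|A| * 8 ^ #|J| <= \sum_(x in G) #|B x|.
  under eq_bigr do rewrite -sum1_card.
  rewrite (exchange_big_dep xpredT) //= mulnC.
  have ->: 8 ^ #|J| = #|{ffun J -> 'I_8}| by rewrite card_ffun card_ord.
  rewrite -sum_nat_const; apply: leq_sum => v _.
  rewrite -(card_rcoset A (phi v)^-1) -sum1_card; apply: eq_leq.
  apply: eq_bigl => x; rewrite mem_rcoset invgK inE.
  by apply/idP/andP => [Ax | []//]; rewrite Ax -(groupMr _ (phiG v)) sAG.
have ->: 1000 ^ #|J| = 8 ^ #|J| * 125 ^ #|J| by rewrite -expnMn.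
rewrite mulnA (leq_trans (leq_mul double (leqnn _))) //.
rewrite big_distrl -sum_nat_const; apply: leq_sum => x Gx.
exact/card_ap_free_cyclic8/freeB.
Qed.

Section ProductOfCyclic.
Variables (n : nat) (m : 'I_n -> nat).
Hypothesis m_gt0 : forall i, 0 < m i.
Local Notation J := {i : 'I_n | 8 %| m i}.
Local Notation V8 := {ffun J -> 'I_8}.

(** The coordinates of the embedding of [C_8 ^ J] that are outside [J] are
    [0]. *)
Definition digit (v : V8) (i : 'I_n) : nat := if insub i is Some j then v j else 0.

Definition cyclic8_embed (v : V8) : {dffun forall i : 'I_n, 'Z_(m i)} :=
  [ffun i => inZp (m i %/ 8 * digit v i)].

Lemma digit_dvd (v : V8) (j : J) : digit v (val j) = v j.
Proof. by rewrite /digit valK. Qed.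

Lemma Zp_trunc_dvd8 i : 8 %| m i -> (Zp_trunc (m i)).+2 = m i.
Proof. by move=> dvd8; apply: Zp_cast; apply: leq_trans (dvdn_leq (m_gt0 i) dvd8). Qed.

Lemma cyclic8_embed_mem v : cyclic8_embed v \in prod_cyclic m.
Proof.
apply/setXnP => i; rewrite ffunE /Zp; case: ifP => [_|]; first by rewrite inE.
move=> le_m1; rewrite inE /digit; case: insubP => [j dvd8 _|_].
  by move: le_m1 (dvdn_leq (m_gt0 i) dvd8); lia.
by rewrite muln0; apply/eqP/val_inj; rewrite /= mod0n.
Qed.

Lemma cyclic8_embedD u v : cyclic8_embed (u + v)%R = (cyclic8_embed u * cyclic8_embed v)%g.
Proof.
apply/ffunP => i; rewrite mulg_ffun !ffunE; apply/val_inj.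
rewrite /= /digit modnDm; case: insubP => [j dvd8 ej|_]; last by rewrite muln0.
rewrite Zp_trunc_dvd8 // ffunE /= -mulnDr muln_modr.
by rewrite divnK // modn_mod.
Qed.

Lemma cyclic8_embed_inj : injective cyclic8_embed.
Proof.
move=> u v e; apply/ffunP => j; apply/val_inj.
move/ffunP/(_ (val j)): e; rewrite !ffunE => /(congr1 val) /=.
have dvd8 := valP j; rewrite /= !digit_dvd Zp_trunc_dvd8 //.
have m8_gt0 : 0 < m (val j) %/ 8 by rewrite divn_gt0 // dvdn_leq.
have small (w : 'I_8) : m (val j) %/ 8 * w < m (val j).
  by rewrite -[ltnRHS](divnK dvd8) ltn_pmul2l.
by rewrite !modn_small // => /eqP; rewrite eqn_pmul2l // => /eqP.
Qed.

End ProductOfCyclic.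

Local Open Scope ring_scope.

Theorem corollary1p2 (R : realFieldType) (gT : finGroupType) (G : {group gT})
    (n : nat) (m : 'I_n -> nat)
    (abelG : abelian G)
    (m_gt0 : forall i : 'I_n, (0 < m i)%N)
    (m_dvd : forall i j : 'I_n, (i <= j)%N -> (m i %| m j)%N)
    (isoG : G \isog prod_cyclic m) :
  (r3 G)%:R <= (886%:R / 1000%:R) ^+ rk8 m * #|G|%:R :> R.
Proof.
have r3_le (A : {set gT}) : A \subset G -> progression_free A ->
    (#|A| * 1000 ^ rk8 m <= #|G| * 886 ^ rk8 m)%N.
  move=> sAG freeA.
  have [f inj_f imf] : exists2 f : {morphism prod_cyclic m >-> gT},
      ('injm f)%g & (f @* prod_cyclic m)%g = G by apply/isogP; rewrite isog_sym.
  have <-: #|{: {i : 'I_n | (8 %| m i)%N}}| = rk8 m.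
    by rewrite card_sig /rk8; apply: eq_card => i; rewrite !inE.
  pose phi v := f (cyclic8_embed (m := m) v).
  have emb := cyclic8_embed_mem m_gt0.
  apply: (card_progression_free_cyclic8 (phi := phi)) => // [u v|u v e|v].
  - by rewrite /phi cyclic8_embedD // morphM ?emb.
  - by apply: (cyclic8_embed_inj m_gt0); apply: (injmP inj_f) e; apply: emb.
  - by rewrite -imf mem_morphim ?emb.
have {r3_le} : (r3 G * 1000 ^ rk8 m <= #|G| * 886 ^ rk8 m)%N.
  rewrite /r3; have [|A /andP[sAG freeA] ->] := @eq_bigmax_cond _
    [pred A : {set gT} | (A \subset G) && progression_free A] (fun A => #|A|).
    apply/card_gt0P; exists set0; rewrite inE sub0set.
    by apply/forall_inP => a; rewrite inE.
  exact: r3_le.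
rewrite -(ler_nat R) !natrM !natrX expr_div_n mulrAC ler_pdivlMr ?exprn_gt0 ?ltr0n //.
by rewrite [X in _ <= X]mulrC.
Qed.
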